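(* Let $I$ be an instance of Max KP on $n$ items that has an equivalent graph. Then $I$ can be solved in time $O(n^2)$, that is, a feasible solution of maximum total profit can be computed in time $O(n^2)$.
   Context: Max KP: an instance consists of a set $A=\{a_1,\ldots,a_n\}$ of $n$ items, where item $a_j$ has a non-negative real size $s_j$ and a non-negative real profit $p_j$, and a non-negative real capacity $c$. The task is to find $A'\subseteq A$ with $\sum_{a_j\in A'}s_j\le c$ (a feasible solution) that maximizes $\sum_{a_j\in A'}p_j$. A Max KP instance $I$ and a finite simple undirected graph $G=(V,E)$ are equivalent if there is a bijection $f:A\to V$ such that, for every $A'\subseteq A$, $A'$ is a feasible solution of $I$ if and only if $f(A')$ is an independent set of $G$. *)

(* Defs.v *)
From mathcomp Require Import all_boot all_order all_algebra.
From mathcomp Require Import boolp classical_sets reals topology normedtype.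
From mathcomp Require Import landau sequences.
Import Order.TTheory GRing.Theory Num.Theory.
Import numFieldNormedType.Exports.

Set Implicit Arguments.
Unset Strict Implicit.
Unset Printing Implicit Defensive.

Local Open Scope ring_scope.

Record maxKP (R : realType) (n : nat) := MaxKP {
  item_size : 'I_n -> R;
  item_profit : 'I_n -> R;
  capacity : R;
  item_size_ge0 : forall j, 0 <= item_size j;
  item_profit_ge0 : forall j, 0 <= item_profit j;
  capacity_ge0 : 0 <= capacity }.

Definition feasible (R : realType) (n : nat) (I : maxKP R n)
    (A : {set 'I_n}) : Prop :=
  \sum_(j in A) item_size I j <= capacity I.

Definition total_profit (R : realType) (n : nat) (I : maxKP R n)
    (A : {set 'I_n}) : R :=
  \sum_(j in A) item_profit I j.

Definition optimal (R : realType) (n : nat) (I : maxKP R n)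
    (A : {set 'I_n}) : Prop :=
  feasible I A /\
  forall B : {set 'I_n}, feasible I B -> total_profit I B <= total_profit I A.

Record sgraph := SGraph {
  vertex : finType;
  adj : rel vertex;
  adj_sym : symmetric adj;
  adj_irrefl : irreflexive adj }.

Definition independent (G : sgraph) (S : {set vertex G}) : Prop :=
  {in S &, forall u v, ~~ adj u v}.

Definition equivalent (R : realType) (n : nat) (I : maxKP R n)
    (G : sgraph) : Prop :=
  exists f : 'I_n -> vertex G, bijective f /\
  forall A : {set 'I_n}, feasible I A <-> independent (f @: A).

Definition has_equivalent_graph (R : realType) (n : nat) (I : maxKP R n) : Prop :=
  exists G : sgraph, equivalent I G.

(* Running time is measured on a real RAM (uniform cost).  The machine has    *)
(* index registers and an index memory holding natural numbers, and real      *)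
(* registers and a real memory holding exact real numbers.  Registers are     *)
(* named by constants of the program, memory cells are addressed through      *)
(* index registers.  Reals cannot be rounded or converted to indices, and a   *)
(* program contains no real constants besides natural numbers.                *)
Inductive instr :=
  | IConst (d k : nat)      (* ireg[d] := k *)
  | IAdd (d a b : nat)      (* ireg[d] := ireg[a] + ireg[b] *)
  | ISub (d a b : nat)      (* ireg[d] := ireg[a] - ireg[b], truncated *)
  | ILoad (d a : nat)       (* ireg[d] := imem[ireg[a]] *)
  | IStore (a b : nat)      (* imem[ireg[a]] := ireg[b] *)
  | RConst (d k : nat)      (* rreg[d] := k *)
  | RAdd (d a b : nat)      (* rreg[d] := rreg[a] + rreg[b] *)
  | RSub (d a b : nat)      (* rreg[d] := rreg[a] - rreg[b] *)
  | RMul (d a b : nat)      (* rreg[d] := rreg[a] * rreg[b] *)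
  | RDiv (d a b : nat)      (* rreg[d] := rreg[a] / rreg[b], 0 if rreg[b] = 0 *)
  | RLoad (d a : nat)       (* rreg[d] := rmem[ireg[a]] *)
  | RStore (a b : nat)      (* rmem[ireg[a]] := rreg[b] *)
  | Jump (l : nat)
  | JumpILe (a b l : nat)   (* if ireg[a] <= ireg[b] go to l *)
  | JumpRLe (a b l : nat)   (* if rreg[a] <= rreg[b] go to l *)
  | Halt.

Definition program := seq instr.

Record state (R : realType) := State {
  pc : nat;
  ireg : nat -> nat;
  imem : nat -> nat;
  rreg : nat -> R;
  rmem : nat -> R }.

Definition exec (R : realType) (c : instr) (s : state R) : option (state R) :=
  let: State pc ir im rr rm := s in
  match c with
  | IConst d k => Some (State pc.+1 [eta ir with d |-> k] im rr rm)
  | IAdd d a b => Some (State pc.+1 [eta ir with d |-> (ir a + ir b)%N] im rr rm)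
  | ISub d a b => Some (State pc.+1 [eta ir with d |-> (ir a - ir b)%N] im rr rm)
  | ILoad d a => Some (State pc.+1 [eta ir with d |-> im (ir a)] im rr rm)
  | IStore a b => Some (State pc.+1 ir [eta im with ir a |-> ir b] rr rm)
  | RConst d k => Some (State pc.+1 ir im [eta rr with d |-> k%:R] rm)
  | RAdd d a b => Some (State pc.+1 ir im [eta rr with d |-> rr a + rr b] rm)
  | RSub d a b => Some (State pc.+1 ir im [eta rr with d |-> rr a - rr b] rm)
  | RMul d a b => Some (State pc.+1 ir im [eta rr with d |-> rr a * rr b] rm)
  | RDiv d a b => Some (State pc.+1 ir im [eta rr with d |-> rr a / rr b] rm)
  | RLoad d a => Some (State pc.+1 ir im [eta rr with d |-> rm (ir a)] rm)
  | RStore a b => Some (State pc.+1 ir im rr [eta rm with ir a |-> rr b])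
  | Jump l => Some (State l ir im rr rm)
  | JumpILe a b l =>
      Some (State (if (ir a <= ir b)%N then l else pc.+1) ir im rr rm)
  | JumpRLe a b l =>
      Some (State (if rr a <= rr b then l else pc.+1) ir im rr rm)
  | Halt => None
  end.

(* None: the machine has halted, also by leaving the program. *)
Definition step (R : realType) (P : program) (s : state R) : option (state R) :=
  exec (nth Halt P (pc s)) s.

Fixpoint run (R : realType) (P : program) (t : nat) (s : state R) : state R :=
  if t is t'.+1 then
    if step P s is Some s' then run P t' s' else s
  else s.

Definition halted (R : realType) (P : program) (s : state R) : Prop :=
  step P s = None.

(* Input convention: ireg[0] = n, rreg[0] = capacity, rmem[j] = size of item  *)
(* j and rmem[n + j] = profit of item j for j < n; all other cells are 0.     *)
Definition input (R : realType) (n : nat) (I : maxKP R n) : state R :=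
  State 0 [eta (fun=> 0%N) with 0%N |-> n] (fun=> 0%N)
    [eta (fun=> 0) with 0%N |-> capacity I]
    (nth 0 (codom (item_size I) ++ codom (item_profit I))).

(* Output convention: item j is selected iff imem[j] is nonzero. *)
Definition output (R : realType) (n : nat) (s : state R) : {set 'I_n} :=
  [set j : 'I_n | imem s j != 0%N]%SET.

Definition solves_within (R : realType) (P : program) (t : nat)
    (n : nat) (I : maxKP R n) : Prop :=
  let s := run P t (input I) in
  halted P s /\ optimal I (output n s).

(* Main.v *)
Require Import Defs.
From mathcomp Require Import all_boot all_order all_algebra.
From mathcomp Require Import reals topology normedtype landau.
From mathcomp Require Import zify.
Import Order.TTheory GRing.Theory Num.Theory.
Import numFieldNormedType.Exports.
Local Open Scope ring_scope.
Local Open Scope classical_set_scope.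

(** An instance with an equivalent graph has all its constraints between pairs
    of items: a set is feasible as soon as any two of its items fit together.
    Let [m] be an item of maximum size in a feasible set [B].  Then [B] is
    contained in the set [S m] made of [m] and of all items [j] with
    [s_j <= s_m] and [s_j + s_m <= c], and [S m] is itself feasible, since
    [s_j + s_k <= s_j + s_m <= c].  Profits being non-negative, the best of the
    [n] sets [S m] is optimal, and the profit of each of them is computed in
    linear time. *)

(** * Pairwise feasibility *)

Section Candidates.
Context {R : realType} {n : nat} (I : maxKP R n).
Implicit Types (i j m : 'I_n) (A B : {set 'I_n}).

Let sz := item_size I.

Definition fits_below m j : bool :=
  (sz j + sz m <= capacity I) && (sz j <= sz m).

Definition candidate m : {set 'I_n} := [set j | (j == m) || fits_below m j]%SET.

(* [m] passes its own test [fits_below m m] exactly when [2 s_m <= c]; otherwise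
   its profit has to be added separately. *)
Lemma total_profit_candidate m :
  total_profit I (candidate m) =
    (if sz m + sz m <= capacity I then 0 else item_profit I m) +
    \sum_(j | fits_below m j) item_profit I j.
Proof.
rewrite /total_profit (bigD1 m) ?inE ?eqxx //=.
have candE : \sum_(i | (i \in candidate m) && (i != m)) item_profit I i =
            \sum_(i | fits_below m i && (i != m)) item_profit I i.
  by apply: eq_bigl => i; rewrite inE; case: eqVneq; rewrite ?andbF.
rewrite candE; case: ifPn => fits_mm.
  by rewrite add0r [RHS](bigD1 m) // /fits_below fits_mm lexx.
congr (_ + _); apply: eq_bigl => i; case: eqVneq => [->|_]; rewrite ?andbT //.
by rewrite andbF /fits_below (negPf fits_mm).
Qed.

Lemma feasible_pair A i j :
  feasible I A -> i \in A -> j \in A -> i != j -> sz i + sz j <= capacity I.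
Proof.
move=> feasA Ai Aj neq_ij; apply: le_trans feasA.
rewrite (bigD1 i) //= (bigD1 j) /=; last by rewrite Aj eq_sym.
rewrite addrA lerDl; apply: sumr_ge0 => k _; exact: item_size_ge0.
Qed.

Lemma candidate_pair m i j :
  i \in candidate m -> j \in candidate m -> i != j ->
  sz i + sz j <= capacity I.
Proof.
rewrite !inE => /orP[/eqP->|/andP[im i_le]] /orP[/eqP->|/andP[jm j_le]] //.
- by rewrite eqxx.
- by rewrite addrC.
- by move=> _; apply: le_trans im; rewrite lerD2l.
Qed.

Lemma feasible_sub_candidate B i0 :
  feasible I B -> i0 \in B -> exists m, B \subset candidate m.
Proof.
move=> feasB Bi0.
have [m Bm m_max] := @arg_maxP _ R _ i0 (mem B) sz Bi0.
exists m; apply/subsetP => j Bj; rewrite inE; case: eqVneq => //= neq_jm.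
by rewrite /fits_below (feasible_pair _ _ _ feasB) //=; exact: m_max.
Qed.

Lemma le_total_profit A B :
  A \subset B -> total_profit I A <= total_profit I B.
Proof.
move=> /subsetP sAB; rewrite /total_profit [leRHS](big_setID A) /=.
have /setIidPr-> : A \subset B by apply/subsetP.
by rewrite lerDl; apply: sumr_ge0 => k _; exact: item_profit_ge0.
Qed.

Hypothesis graphI : has_equivalent_graph I.

(** Independence constrains only pairs of vertices: the equivalence sends feasible pairs to
    non-adjacent ones, and an independent image back to a feasible set. *)
Lemma pairwise_feasible A :
  {in A &, forall i j, i != j -> sz i + sz j <= capacity I} -> feasible I A.
Proof.
case: graphI => G [f [_ equivI]] pairA; apply/equivI.
move=> _ _ /imsetP[i Ai ->] /imsetP[j Aj ->].
have [->|neq_ij] := eqVneq i j; first by rewrite adj_irrefl.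
have feas_ij : feasible I [set i; j]%SET.
  by rewrite /feasible big_setU1 ?inE //= big_set1 pairA.
by move/equivI: feas_ij; apply; apply: imset_f; rewrite !inE eqxx ?orbT.
Qed.

Lemma best_candidate_optimal m :
  (forall i, total_profit I (candidate i) <= total_profit I (candidate m)) ->
  optimal I (candidate m).
Proof.
move=> best_m; split; first exact/pairwise_feasible/candidate_pair.
move=> B feasB; have [->|[i0 Bi0]] := set_0Vmem B.
  by apply: le_total_profit; exact: sub0set.
have [i sBi] := feasible_sub_candidate _ _ feasB Bi0.
exact: le_trans (le_total_profit _ _ sBi) (best_m i).
Qed.

(** Without items there is no best candidate to output, so this case is separate. *)
Lemma optimal_no_items A : n = 0%N -> optimal I A.
Proof.
move=> n0; have no_item B : B = set0.
  by apply/setP => i; have := ltn_ord i; rewrite [X in (_ < X)%N]n0.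
split=> [|B _]; last by rewrite (no_item A) (no_item B).
by rewrite /feasible (no_item A) big_set0; exact: capacity_ge0.
Qed.

End Candidates.

(** * Bounded execution *)

Section Reach.
Context {R : realType} (P : program).
Implicit Types (s : state R) (Q : state R -> Prop).

(** Bounding the step count, rather than fixing it, lets branches of different lengths share one
    [t]. *)
Definition reach t s Q : Prop := exists2 k, (k <= t)%N & Q (run P k s).

Lemma reach_refl t s Q : Q s -> reach t s Q.
Proof. by exists 0%N. Qed.

Lemma reach_step t s s' Q :
  step P s = Some s' -> reach t s' Q -> reach t.+1 s Q.
Proof. by move=> ss' [k kt Qk]; exists k.+1; rewrite //= ss'. Qed.

Lemma reach_leq t t' s Q : (t <= t')%N -> reach t s Q -> reach t' s Q.
Proof. by move=> tt' [k kt Qk]; exists k => //; apply: leq_trans tt'. Qed.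

Lemma run_halted t s : halted P s -> run P t s = s.
Proof. by case: t => //= t ->. Qed.

Lemma runD a b s : run P (a + b) s = run P b (run P a s).
Proof.
elim: a s => //= a IHa s; case E: (step P s) => [s'|] //.
by rewrite run_halted.
Qed.

(** A halted state is a fixed point of [run], so going on to exactly [t] steps changes nothing. *)
Lemma reach_halted t s Q :
  reach t s (fun s' => halted P s' /\ Q s') ->
  halted P (run P t s) /\ Q (run P t s).
Proof.
by move=> [k kt [haltk Qk]]; rewrite -(subnKC kt) runD run_halted.
Qed.

End Reach.

(** * The program *)

(* Index registers: 0 = n, 1 = m, 2 = j, 3 = 1, 4 = scratch, 5 = best m so far,
   6 = 0.  Real registers: 0 = c, 1 = s_m, 2 = profit of S m so far, 3 = s_j,
   4 = scratch, 5 = best profit so far, 6 = 0. *)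
Definition kp_program : program := [::
  (*  0 *) IConst 3 1;
  (*  1 *) JumpILe 0 1 26;
  (*  2 *) RLoad 1 1;
  (*  3 *) RConst 2 0;
  (*  4 *) RAdd 4 1 1;
  (*  5 *) JumpRLe 4 0 8;
  (*  6 *) IAdd 4 0 1;
  (*  7 *) RLoad 2 4;
  (*  8 *) IConst 2 0;
  (*  9 *) JumpILe 0 2 21;
  (* 10 *) RLoad 3 2;
  (* 11 *) RAdd 4 3 1;
  (* 12 *) JumpRLe 4 0 14;
  (* 13 *) Jump 19;
  (* 14 *) JumpRLe 3 1 16;
  (* 15 *) Jump 19;
  (* 16 *) IAdd 4 0 2;
  (* 17 *) RLoad 4 4;
  (* 18 *) RAdd 2 2 4;
  (* 19 *) IAdd 2 2 3;
  (* 20 *) Jump 9;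
  (* 21 *) JumpRLe 2 5 24;
  (* 22 *) RAdd 5 2 6;
  (* 23 *) IAdd 5 1 6;
  (* 24 *) IAdd 1 1 3;
  (* 25 *) Jump 1;
  (* 26 *) RLoad 1 5;
  (* 27 *) IConst 2 0;
  (* 28 *) JumpILe 0 2 38;
  (* 29 *) RLoad 3 2;
  (* 30 *) RAdd 4 3 1;
  (* 31 *) JumpRLe 4 0 33;
  (* 32 *) Jump 36;
  (* 33 *) JumpRLe 3 1 35;
  (* 34 *) Jump 36;
  (* 35 *) IStore 2 3;
  (* 36 *) IAdd 2 2 3;
  (* 37 *) Jump 28;
  (* 38 *) IStore 5 3;
  (* 39 *) Halt].

Ltac exec1 := apply: reach_step; [reflexivity | rewrite /=].

(** * Loop invariants and step counts *)

Section Program.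
Context {R : realType} (n : nat) (c : R) (rm : nat -> R).
Implicit Types (ir im : nat -> nat) (rr : nat -> R) (Q : state R -> Prop).
Local Open Scope nat_scope.

Definition cell_fits (m j : nat) : bool :=
  ((rm j + rm m <= c) && (rm j <= rm m))%R.

(** The content of real register 2 once the inner loop for [m] has scanned the items below [k]. *)
Definition cell_profit (m k : nat) : R :=
  ((if rm m + rm m <= c then 0 else rm (n + m)%N) +
   \sum_(0 <= j < k | cell_fits m j) rm (n + j)%N)%R.

Lemma cell_profitS m k :
  cell_profit m k.+1 =
    (if cell_fits m k then cell_profit m k + rm (n + k)%N
     else cell_profit m k)%R.
Proof.
rewrite /cell_profit [in LHS]big_mkcond big_nat_recr //= -big_mkcond /=.
by case: (cell_fits m k); rewrite ?addr0 ?addrA.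
Qed.

Definition ready ir rr : Prop :=
  [/\ ir 0 = n, ir 3 = 1, ir 6 = 0, rr 0 = c & rr 6 = 0%R].

(** The rest of the run enters as a continuation of cost [t]. A pass takes at most 10 instructions,
    so 12 leaves slack; the extra 1 is the exit test. *)
Lemma profit_loop t d k ir im rr Q :
  ready ir rr -> ir 2 = k -> k + d = n -> rr 1 = rm (ir 1) ->
  rr 2 = cell_profit (ir 1) k ->
  (forall ir' rr', ready ir' rr' -> ir' 1 = ir 1 -> ir' 5 = ir 5 ->
     rr' 5 = rr 5 -> rr' 2 = cell_profit (ir 1) n ->
     reach kp_program t (State 21 ir' im rr' rm) Q) ->
  reach kp_program (12 * d + 1 + t) (State 9 ir im rr rm) Q.
Proof.
elim: d k ir rr => [|d IHd] k ir rr [ir0 ir3 ir6 rr0 rr6] ir2 kd rr1 rr2 cont.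
  rewrite muln0 add0n add1n; exec1; rewrite ir0 ir2 -kd addn0 leqnn.
  by apply: cont => //; rewrite -kd addn0.
apply: (@reach_leq _ _ (12 * d + 1 + t).+4.+4.+4); first by lia.
exec1; have -> : (ir 0 <= ir 2) = false by lia.
exec1; exec1; exec1; rewrite ir2 rr1 rr0.
(* Only the right side of [fitsE] gets unfolded, so the two machine comparisons below evaluate the
   folded test on its left. *)
have fitsE := erefl (cell_fits (ir 1) k).
rewrite {2}/cell_fits in fitsE.
case: leP fitsE => [_|_] /= fitsE; last first.
  exec1; exec1; exec1.
  apply: reach_leq; last apply: (IHd k.+1) => //=; try lia.
  by rewrite cell_profitS fitsE.
exec1; rewrite rr1.
case: leP fitsE => [_|_] /= fitsE; last first.
  exec1; exec1; exec1.
  apply: reach_leq; last apply: (IHd k.+1) => //=; try lia.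
  by rewrite cell_profitS fitsE.
exec1; exec1; exec1; exec1; exec1.
apply: reach_leq; last apply: (IHd k.+1) => //=; try lia.
by rewrite cell_profitS fitsE rr2 ir0 ir2.
Qed.

(** An inequality [v <= cell_profit b n] suffices and admits the start [b = 0], [v = 0]; at [m = n]
    the two bounds make [b] maximal. *)
Definition is_best (m b : nat) (v : R) : Prop :=
  [/\ (0 < n -> b < n /\ (v <= cell_profit b n)%R) &
      forall i, i < m -> (cell_profit i n <= v)%R].

Lemma candidate_loop t d ir im rr Q :
  ready ir rr -> ir 1 + d = n -> is_best (ir 1) (ir 5) (rr 5) ->
  (forall ir' rr', ready ir' rr' -> is_best n (ir' 5) (rr' 5) ->
     reach kp_program t (State 26 ir' im rr' rm) Q) ->
  reach kp_program (d * (12 * n + 14) + 1 + t) (State 1 ir im rr rm) Q.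
Proof.
elim: d ir rr => [|d IHd] ir rr rdy md best cont.
  case: (rdy) => ir0 ir3 ir6 rr0 rr6.
  rewrite mul0n add0n add1n; exec1; have -> : ir 0 <= ir 1 by lia.
  by apply: cont => //; rewrite -md addn0.
case: rdy => ir0 ir3 ir6 rr0 rr6.
pose t0 := d * (12 * n + 14) + 1 + t.
have after ir' rr' : ready ir' rr' -> ir' 1 = ir 1 -> ir' 5 = ir 5 ->
    rr' 5 = rr 5 -> rr' 2 = cell_profit (ir 1) n ->
    reach kp_program t0.+4.+1 (State 21 ir' im rr' rm) Q.
  move=> [ir0' ir3' ir6' rr0' rr6'] ir1' ir5' rr5' rr2'.
  case: best => bestn best.
  exec1; rewrite rr2' rr5'; case: leP => le_v.
    exec1; exec1; apply: (@reach_leq _ _ t0); first by lia.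
    apply: IHd => //=; first by lia.
    rewrite ir1' ir3' ir5' rr5'; split=> // i; rewrite addn1 ltnS leq_eqVlt.
    by case/orP=> [/eqP->|/best].
  exec1; exec1; exec1; exec1.
  apply: IHd => //=; first by lia.
  rewrite ir1' ir3' ir6' rr2' rr6' addn0 addr0; split.
    by move=> _; split; [lia | exact: lexx].
  move=> i; rewrite addn1 ltnS leq_eqVlt => /orP[/eqP->//|/best le_i].
  exact: le_trans le_i (ltW le_v).
have loop ir' rr' : ready ir' rr' -> ir' 1 = ir 1 -> ir' 5 = ir 5 ->
    rr' 5 = rr 5 -> rr' 1 = rm (ir 1) -> rr' 2 = cell_profit (ir 1) 0 ->
    reach kp_program (12 * n + 1 + t0.+4.+1).+1 (State 8 ir' im rr' rm) Q.
  move=> [ir0' ir3' ir6' rr0' rr6'] ir1' ir5' rr5' rr1' rr2'.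
  by exec1; apply: (@profit_loop _ _ 0) => //=; rewrite ?ir1' ?ir5' ?rr5' //.
apply: (@reach_leq _ _ (12 * n + 1 + t0.+4.+1).+1.+4.+3); first by lia.
exec1; have -> : (ir 0 <= ir 1) = false by lia.
exec1; exec1; exec1; exec1; rewrite rr0.
case: leP => [fits_mm|unfit_mm].
  apply: reach_leq; last apply: loop => //=; first by lia.
  by rewrite /cell_profit big_geq // fits_mm addr0.
exec1; exec1; apply: loop => //=.
by rewrite /cell_profit big_geq // leNgt unfit_mm addr0 ir0.
Qed.

(** The best item may fail its own test; the store at instruction 38 marks it in any case. *)
Lemma output_loop t d k ir im rr Q :
  ready ir rr -> ir 2 = k -> k + d = n -> rr 1 = rm (ir 5) ->
  (forall j, (im j != 0) = (j < k) && cell_fits (ir 5) j) ->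
  (forall ir' im' rr', ready ir' rr' -> ir' 5 = ir 5 ->
     (forall j, (im' j != 0) = (j < n) && cell_fits (ir 5) j) ->
     reach kp_program t (State 38 ir' im' rr' rm) Q) ->
  reach kp_program (10 * d + 1 + t) (State 28 ir im rr rm) Q.
Proof.
elim: d k ir im rr => [|d IHd] k ir im rr
  [ir0 ir3 ir6 rr0 rr6] ir2 kd rr1 imE cont.
  rewrite muln0 add0n add1n; exec1; have -> : ir 0 <= ir 2 by lia.
  by apply: cont => // j; rewrite imE -kd addn0.
apply: (@reach_leq _ _ (10 * d + 1 + t).+4.+4.+2); first by lia.
exec1; have -> : (ir 0 <= ir 2) = false by lia.
exec1; exec1; exec1; rewrite ir2 rr1 rr0.
have fitsE := erefl (cell_fits (ir 5) k).
rewrite {2}/cell_fits in fitsE.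
case: leP fitsE => [_|_] /= fitsE; last first.
  exec1; exec1; exec1.
  apply: reach_leq; last apply: (IHd k.+1) => //=; try lia.
  move=> j; rewrite imE ltnS [in RHS]leq_eqVlt.
  by case: eqVneq => [->|//]; rewrite fitsE !andbF.
exec1; rewrite rr1.
case: leP fitsE => [_|_] /= fitsE; last first.
  exec1; exec1; exec1.
  apply: reach_leq; last apply: (IHd k.+1) => //=; try lia.
  move=> j; rewrite imE ltnS [in RHS]leq_eqVlt.
  by case: eqVneq => [->|//]; rewrite fitsE !andbF.
exec1; exec1; exec1.
apply: reach_leq; last apply: (IHd k.+1) => //=; try lia.
move=> j; rewrite ltnS [in RHS]leq_eqVlt ir2 ir3.
by case: (eqVneq j k) => [->|_]; rewrite ?fitsE ?imE.
Qed.

Definition kp_time : nat := n * (12 * n + 14) + 10 * n + 10.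

Lemma kp_program_correct ir im rr :
  ir 0 = n -> ir 1 = 0 -> ir 5 = 0 -> ir 6 = 0 -> im =1 (fun=> 0) ->
  rr 0 = c -> rr 5 = 0%R -> rr 6 = 0%R -> (forall j, (0 <= rm j)%R) ->
  reach kp_program kp_time (State 0 ir im rr rm) (fun s =>
    halted kp_program s /\ exists b,
      [/\ 0 < n -> b < n,
          forall i, i < n -> (cell_profit i n <= cell_profit b n)%R &
          forall j, j < n -> (imem s j != 0) = (j == b) || cell_fits b j]).
Proof.
move=> ir0 ir1 ir5 ir6 im0 rr0 rr5 rr6 rm_ge0.
apply: (@reach_leq _ _
  (n * (12 * n + 14) + 1 + (10 * n + 1 + 1).+2).+1).
  by rewrite /kp_time; lia.
exec1; apply: candidate_loop => //=; first by rewrite ir1.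
  rewrite ir1 ir5 rr5; split=> // n_gt0; split=> //.
  (* Non-negative memory makes the initial value 0 a lower bound for the profit of candidate 0. *)
  rewrite /cell_profit addr_ge0 //; first by case: ifP.
  by apply: sumr_ge0.
move=> ir' rr' [ir0' ir3' ir6' rr0' rr6'] [bestn best].
exec1; exec1; apply: (@output_loop _ _ 0) => //=.
  by move=> j; rewrite im0.
move=> ir'' im'' rr'' [ir0'' ir3'' ir6'' rr0'' rr6''] /= ir5'' im''E.
exec1; apply: reach_refl; split=> //; exists (ir' 5); split.
- by case/bestn.
- move=> i lt_in; have [_ le_b] := bestn (leq_ltn_trans (leq0n i) lt_in).
  exact: le_trans (best i lt_in) le_b.
- move=> j lt_jn; rewrite /= ir5'' ir3''; case: (eqVneq j (ir' 5)) => //= _.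
  by rewrite im''E lt_jn.
Qed.

End Program.

(** * Correctness and running time *)

Section Correctness.
Context {R : realType} {n : nat} (I : maxKP R n).

Let rm := rmem (input I).

Lemma input_size (j : 'I_n) : rm j = item_size I j.
Proof.
rewrite /rm /= nth_cat size_codom card_ord ltn_ord.
by rewrite (nth_map j) ?size_enum_ord // nth_ord_enum.
Qed.

Lemma input_profit (j : 'I_n) : rm (n + j)%N = item_profit I j.
Proof.
rewrite /rm /= nth_cat size_codom card_ord ltnNge leq_addr /= addKn.
by rewrite (nth_map j) ?size_enum_ord // nth_ord_enum.
Qed.

Lemma input_ge0 j : 0 <= rm j.
Proof.
have [lt_jn|le_nj] := ltnP j n.
  by rewrite (input_size (Ordinal lt_jn)); exact: item_size_ge0.
have [lt_jn|le_nnj] := ltnP (j - n) n.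
  by rewrite -(subnKC le_nj) (input_profit (Ordinal lt_jn)) item_profit_ge0.
(* Cells from [2 n] on hold the default 0 of [nth]. *)
by rewrite /rm /= nth_default // size_cat !size_codom card_ord; lia.
Qed.

Lemma input_fits (m j : 'I_n) :
  cell_fits (capacity I) rm m j = fits_below I m j.
Proof. by rewrite /cell_fits /fits_below !input_size. Qed.

Lemma input_candidate_profit (m : 'I_n) :
  cell_profit n (capacity I) rm m n = total_profit I (candidate I m).
Proof.
rewrite /cell_profit total_profit_candidate !input_size input_profit big_mkord.
congr (_ + _); apply: eq_big => j; first exact: input_fits.
by rewrite input_profit.
Qed.

Lemma kp_program_solves :
  has_equivalent_graph I -> solves_within kp_program (kp_time n) I.
Proof.
move=> graphI; apply: (@reach_halted _ _ _ _ (fun s => optimal I (output n s))).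
have := @kp_program_correct R n (capacity I) rm (ireg (input I))
  (imem (input I)) (rreg (input I)).
case=> //; first exact: input_ge0.
move=> k kt [haltk [b [b_lt best imE]]]; exists k => //; split=> //.
have [n0|n_gt0] := posnP n; first exact: optimal_no_items.
pose m := Ordinal (b_lt n_gt0).
have -> : output n (run kp_program k (input I)) = candidate I m.
  by apply/setP => j; rewrite !inE imE // (input_fits m).
apply: best_candidate_optimal => // i.
by rewrite -!input_candidate_profit; exact: best.
Qed.

End Correctness.

Theorem theorem3p29 (R : realType) :
  exists (P : program) (T : nat -> nat),
    ((fun n : nat => (T n)%:R : R) =O_\oo (fun n : nat => n%:R ^+ 2 : R)) /\
    forall (n : nat) (I : maxKP R n),
      has_equivalent_graph I -> solves_within P (T n) I.
Proof.
exists kp_program, kp_time; split; last by move=> n I; exact: kp_program_solves.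
(* [kp_time n] is [12 n^2 + 24 n + 10], at most [(12 + 24 + 10) n^2] for [n >= 1]. *)
apply/eqO_exP; exists 46; first by rewrite ltr0n.
near=> n.
have n_gt0 : (0 < n)%N by near: n; exact: nbhs_infty_gt.
rewrite ger0_norm ?ler0n // ger0_norm ?exprn_ge0 // -natrX -natrM ler_nat.
by rewrite /kp_time; nia.
Unshelve. all: by end_near.
Qed.
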